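(* Let $(X,\tau)$ be a torsor, let $(G,+,0)$ be an abelian group equipped with a bilinear (biadditive) map $[\cdot,\cdot]:G^{\times 2}\to G$, and let $f_1,f_2,f_3:X^{\times 3}\to X^{\times 3}$ be given by $$f_1(x,y,z)=(\tau(x,y,z),z,y),\quad f_2(x,y,z)=(y,x,\tau(x,y,z)),\quad f_3(x,y,z)=(z,\tau(x,y,z),x).$$ Let $\gamma:X^{\times 3}\to G$ be any map satisfying $\gamma\circ f_1+\gamma\circ f_2=0$. For either choice of sign $\pm$ (fixed throughout), define for maps $\varphi:X^{\times 3}\to G$ $$\partial^{\gamma}_{[\cdot,\cdot]}\varphi:=\bigl[\gamma,\varphi\circ f_1\pm\varphi\circ f_2\bigr].$$ Then for every $\varphi:X^{\times 3}\to G$ one has $\partial^{\gamma}_{[\cdot,\cdot]}\bigl(\partial^{\gamma}_{[\cdot,\cdot]}\varphi\bigr)=0$ and $$(\partial^{\gamma}_{[\cdot,\cdot]}\varphi)\circ f_1\pm(\partial^{\gamma}_{[\cdot,\cdot]}\varphi)\circ f_2=0.$$ Moreover, in the case of the sign $+$, if $[\cdot,\cdot]$ is a Lie bracket, then for all $\varphi,\phi:X^{\times 3}\to G$ the induced bracket on maps satisfies the modified Leibniz rule $$\partial^{\gamma}_{[\cdot,\cdot]}[\varphi,\phi+\phi\circ f_3]=\partial^{\gamma}_{[\cdot,\cdot]}[\varphi+\varphi\circ f_3,\phi]=\partial^{\partial^{\gamma}_{[\cdot,\cdot]}\varphi}_{[\cdot,\cdot]}\phi-\partial^{\partial^{\g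amma}_{[\cdot,\cdot]}\phi}_{[\cdot,\cdot]}\varphi.$$
   Context: A torsor $(X,\tau)$ is a non-empty set $X$ with a ternary operation $\tau:X^{\times 3}\to X$ such that $\tau(x,y,y)=x=\tau(y,y,x)$ for all $x,y\in X$ and $\tau(\tau(x,y,z),v,w)=\tau(x,y,\tau(z,v,w))$ for all $x,y,z,v,w\in X$. Sums and brackets of maps $X^{\times 3}\to G$ are taken pointwise: $[\psi_1,\psi_2](x,y,z)=[\psi_1(x,y,z),\psi_2(x,y,z)]$. A Lie bracket on $G$ is a biadditive map that is skew-symmetric and satisfies the Jacobi identity $[x,[y,z]]+[y,[z,x]]+[z,[x,y]]=0$. For a map $\delta:X^{\times 3}\to G$ (such as $\delta=\partial^{\gamma}_{[\cdot,\cdot]}\varphi$), $\partial^{\delta}_{[\cdot,\cdot]}\phi$ denotes $[\delta,\phi\circ f_1\pm\phi\circ f_2]$ with the same sign. *)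

(* Defs.v *)
From mathcomp Require Import all_boot all_algebra.
Set Implicit Arguments.
Unset Strict Implicit.
Unset Printing Implicit Defensive.
Import GRing.Theory.
Local Open Scope ring_scope.

Record is_torsor (X : Type) (tau : X -> X -> X -> X) : Prop := IsTorsor {
  torsor_nonempty : inhabited X;
  torsor_idr : forall x y, tau x y y = x;
  torsor_idl : forall x y, tau y y x = x;
  torsor_assoc : forall x y z v w, tau (tau x y z) v w = tau x y (tau z v w)
}.

Section TorsorMaps.
Variables (X : Type) (tau : X -> X -> X -> X).

Definition f1 (t : X * X * X) : X * X * X :=
  let: (x, y, z) := t in (tau x y z, z, y).

Definition f2 (t : X * X * X) : X * X * X :=
  let: (x, y, z) := t in (y, x, tau x y z).

Definition f3 (t : X * X * X) : X * X * X :=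
  let: (x, y, z) := t in (z, tau x y z, x).

End TorsorMaps.

Section Brackets.
Variables (G : zmodType) (br : G -> G -> G).

Definition biadditive : Prop :=
  left_distributive br +%R /\ right_distributive br +%R.

(* Skew-symmetry is [x, y] = - [y, x]; [x, x] = 0 is not required. *)
Record is_lie_bracket : Prop := IsLieBracket {
  lie_biadditive : biadditive;
  lie_skew : forall x y, br x y = - br y x;
  lie_jacobi : forall x y z,
    br x (br y z) + br y (br z x) + br z (br x y) = 0
}.

Definition map_bracket (T : Type) (psi1 psi2 : T -> G) : T -> G :=
  fun t => br (psi1 t) (psi2 t).

End Brackets.

(* The sign +/- : [false] stands for + and [true] for -, as in (-1) ^+ s. *)
Definition pm_fun (T : Type) (G : zmodType) (s : bool) (g h : T -> G) : T -> G :=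
  if s then g \- h else g \+ h.

(* partial^gamma phi = [gamma, phi o f1 +/- phi o f2] *)
Definition torsor_diff (X : Type) (tau : X -> X -> X -> X) (G : zmodType)
    (br : G -> G -> G) (s : bool) (gamma phi : X * X * X -> G) : X * X * X -> G :=
  map_bracket br gamma (pm_fun s (phi \o f1 tau) (phi \o f2 tau)).

(* Main.v *)
(* The maps [f1] and [f2] are commuting involutions whose product is [f3], so
   they generate a Klein four-group; composing with them only permutes the
   terms below, and the Leibniz rule becomes the Jacobi identity for [gamma],
   [phi o f1 + phi o f2] and [psi o f1 + psi o f2]. *)
Require Import Defs.
From mathcomp Require Import all_boot all_algebra.
Set Implicit Arguments.
Unset Strict Implicit.
Unset Printing Implicit Defensive.
Import GRing.Theory.
Local Open Scope ring_scope.

Section TorsorMapsTheory.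
Variables (X : Type) (tau : X -> X -> X -> X).
Hypothesis tau_torsor : is_torsor tau.

Lemma f1K : involutive (f1 tau).
Proof.
by case: tau_torsor => _ idr idl assoc [[x y] z]; rewrite /f1 assoc idl idr.
Qed.

Lemma f2K : involutive (f2 tau).
Proof.
by case: tau_torsor => _ idr idl assoc [[x y] z]; rewrite /f2 -assoc idr idl.
Qed.

Lemma f1_f2 t : f1 tau (f2 tau t) = f3 tau t.
Proof.
by case: tau_torsor t => _ idr idl assoc [[x y] z]; rewrite /f1 /f2 -assoc idr idl.
Qed.

Lemma f2_f1 t : f2 tau (f1 tau t) = f3 tau t.
Proof.
by case: tau_torsor t => _ idr idl assoc [[x y] z]; rewrite /f1 /f2 assoc idl idr.
Qed.

Lemma f3_f1 t : f3 tau (f1 tau t) = f2 tau t.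
Proof. by rewrite -f2_f1 f1K. Qed.

Lemma f3_f2 t : f3 tau (f2 tau t) = f1 tau t.
Proof. by rewrite -f1_f2 f2K. Qed.

End TorsorMapsTheory.

Section BiadditiveTheory.
Variables (G : zmodType) (br : G -> G -> G).
Hypothesis br_biadd : biadditive br.

Lemma br0r x : br x 0 = 0.
Proof. by apply: (addrI (br x 0)); rewrite -(proj2 br_biadd) !addr0. Qed.

Lemma br0l x : br 0 x = 0.
Proof. by apply: (addrI (br 0 x)); rewrite -(proj1 br_biadd) !addr0. Qed.

(** Additivity in the second argument alone gives this: both sides become 0 once [br x y] is
    added. *)
Lemma brNr x y : br x (- y) = - br x y.
Proof. by apply: (addrI (br x y)); rewrite -(proj2 br_biadd) !subrr br0r. Qed.

End BiadditiveTheory.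

(** The Jacobi identity after skew-symmetry. With [x] a value of [gamma], the right-hand terms have
    the shape of the two nested differentials in the Leibniz rule. *)
Lemma lie_bracket_derivation (G : zmodType) (br : G -> G -> G) :
  is_lie_bracket br ->
  forall x y z, br x (br y z) = br (br x y) z - br (br x z) y.
Proof.
move=> [bi skew jacobi] x y z.
rewrite [br (br x y) z]skew [br (br x z) y]skew [br x z]skew (brNr bi) !opprK.
by apply/eqP; rewrite -subr_eq0 opprD !opprK addrA addrAC; apply/eqP.
Qed.

Section TorsorDifferential.
Variables (X : Type) (tau : X -> X -> X -> X) (G : zmodType).
Variables (br : G -> G -> G) (gamma : X * X * X -> G).
Hypotheses (tau_torsor : is_torsor tau) (br_biadd : biadditive br).

(** At [f1 t] and [f2 t] the second bracket arguments are $\varphi\pm\varphi\circ f_3$ and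
    $\varphi\circ f_3\pm\varphi$, equal up to the sign $\pm$. That sign cancels the outer one, so
    $\gamma\circ f_1+\gamma\circ f_2=0$ factors out. *)
Lemma torsor_diff_pm (s : bool) (phi : X * X * X -> G) :
  (gamma \o f1 tau) \+ (gamma \o f2 tau) =1 \0 ->
  pm_fun s (torsor_diff tau br s gamma phi \o f1 tau)
           (torsor_diff tau br s gamma phi \o f2 tau) =1 \0.
Proof.
move=> gamma_f1f2 t; have /= gamma_t := gamma_f1f2 t.
case: s; rewrite /torsor_diff /map_bracket /= f1K // f2K // f1_f2 // f2_f1 //.
  (* The sign $-$: the outer minus moves inside and reverses the second difference. *)
  by rewrite -(brNr br_biadd) opprB -(proj1 br_biadd) gamma_t br0l.
by rewrite [phi (f3 _ _) + _]addrC -(proj1 br_biadd) gamma_t br0l.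
Qed.

Lemma torsor_diffK (s : bool) (phi : X * X * X -> G) :
  (gamma \o f1 tau) \+ (gamma \o f2 tau) =1 \0 ->
  torsor_diff tau br s gamma (torsor_diff tau br s gamma phi) =1 \0.
Proof.
move=> gamma_f1f2 t.
(* Only the outer differential is unfolded; its second argument vanishes by [torsor_diff_pm]. *)
by rewrite {1}/torsor_diff /map_bracket torsor_diff_pm // br0r.
Qed.

(** $\psi+\psi\circ f_3$ takes the same value at [f1 t] and [f2 t], because [f3] swaps these two
    points; the two brackets then merge by additivity. *)
Lemma torsor_diff_bracketDr (phi psi : X * X * X -> G) t :
  torsor_diff tau br false gamma (map_bracket br phi (psi \+ (psi \o f3 tau))) t
  = br (gamma t) (br (phi (f1 tau t) + phi (f2 tau t))
                     (psi (f1 tau t) + psi (f2 tau t))).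
Proof.
rewrite /torsor_diff /map_bracket /= f3_f1 // f3_f2 //.
by rewrite [psi (f2 _ _) + _]addrC -(proj1 br_biadd).
Qed.

Lemma torsor_diff_bracketDl (phi psi : X * X * X -> G) t :
  torsor_diff tau br false gamma (map_bracket br (phi \+ (phi \o f3 tau)) psi) t
  = br (gamma t) (br (phi (f1 tau t) + phi (f2 tau t))
                     (psi (f1 tau t) + psi (f2 tau t))).
Proof.
rewrite /torsor_diff /map_bracket /= f3_f1 // f3_f2 //.
by rewrite [phi (f2 _ _) + _]addrC -(proj2 br_biadd).
Qed.

End TorsorDifferential.

Theorem proposition3p0p3 (X : Type) (tau : X -> X -> X -> X) (G : zmodType)
    (br : G -> G -> G) (gamma : X * X * X -> G)
    (tau_torsor : is_torsor tau) (br_biadd : biadditive br)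
    (gamma_f1f2 : (gamma \o f1 tau) \+ (gamma \o f2 tau) =1 \0) :
  (forall (s : bool) (phi : X * X * X -> G),
      torsor_diff tau br s gamma (torsor_diff tau br s gamma phi) =1 \0
   /\ pm_fun s (torsor_diff tau br s gamma phi \o f1 tau)
               (torsor_diff tau br s gamma phi \o f2 tau) =1 \0)
  /\ (is_lie_bracket br -> forall phi psi : X * X * X -> G,
      torsor_diff tau br false gamma (map_bracket br phi (psi \+ (psi \o f3 tau)))
        =1 torsor_diff tau br false gamma (map_bracket br (phi \+ (phi \o f3 tau)) psi)
   /\ torsor_diff tau br false gamma (map_bracket br (phi \+ (phi \o f3 tau)) psi)
        =1 torsor_diff tau br false (torsor_diff tau br false gamma phi) psi
           \- torsor_diff tau br false (torsor_diff tau br false gamma psi) phi).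
Proof.
split=> [s phi | br_lie phi psi].
  by split; [exact: torsor_diffK | exact: torsor_diff_pm].
split=> t; rewrite torsor_diff_bracketDl //; first exact: torsor_diff_bracketDr.
(* The resulting right-hand side is, by unfolding, the difference of the nested differentials at
   [t]. *)
by rewrite (lie_bracket_derivation br_lie).
Qed.
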